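(* For integers $m\ge 2$ and $n>m$, there are instances of $n$ jobs that admit a feasible preemptive schedule on $m$ machines for which any deadline-ordered algorithm requires at least $n-1$ machines.
   Context: Machine minimization with deadlines: each job $j$ has release date $r_j$, processing time $p_j$ and deadline $d_j$. A feasible preemptive schedule on a given number of identical machines processes each job for $p_j$ units within $[r_j,d_j]$, each machine processing at most one job at a time, no job on two machines at once; preemption and migration allowed. A deadline-ordered algorithm is a scheduling algorithm that uses only the relative order of the jobs' deadlines rather than their actual values (so on two instances with identical release dates and processing times and the same relative order of deadlines it produces the same schedule); e.g. EDF is deadline-ordered. *)

(* Defs.v *)
From HB Require Import structures.
From mathcomp Require Import all_boot all_order all_algebra.
From mathcomp Require Import all_classical all_reals all_analysis.

Set Implicit Arguments.
Unset Strict Implicit.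
Unset Printing Implicit Defensive.

Import Order.TTheory GRing.Theory Num.Theory.

Local Open Scope classical_set_scope.
Local Open Scope ring_scope.

Record instance (R : realType) (n : nat) := Instance {
  release : 'I_n -> R ;
  proc : 'I_n -> R ;
  deadline : 'I_n -> R ;
  proc_gt0 : forall j, 0 < proc j }.

(* [s i t] is the job run by machine [i] at time [t], [None] if it is idle; in
   particular a machine processes at most one job at a time, and preemption and
   migration are unrestricted. *)
Definition schedule (R : realType) (k n : nat) := 'I_k -> R -> option 'I_n.

Definition busy (R : realType) (k n : nat) (s : schedule R k n)
  (i : 'I_k) (j : 'I_n) : set R := [set t | s i t = Some j].

Definition feasible (R : realType) (k n : nat) (I : instance R n)
    (s : schedule R k n) : Prop :=
  [/\ forall i j, measurable (busy s i j),
      forall i i' t j, s i t = Some j -> s i' t = Some j -> i = i',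
      forall i j t, s i t = Some j -> release I j <= t <= deadline I j
    & forall j, (\sum_(i < k) lebesgue_measure (busy s i j))%E = (proc I j)%:E].

(* An algorithm chooses, for each instance, a number of machines and a schedule
   on that many machines. No feasibility is built in, and the algorithm need not
   be online. *)
Definition algorithm (R : realType) (n : nat) :=
  instance R n -> {k : nat & schedule R k n}.

Definition machines (R : realType) (n : nat) (A : algorithm R n)
  (I : instance R n) : nat := tag (A I).

Definition output (R : realType) (n : nat) (A : algorithm R n)
  (I : instance R n) : schedule R (machines A I) n := tagged (A I).

Arguments output {R n} A I.

Definition same_deadline_order (R : realType) (n : nat)
    (I J : instance R n) : Prop :=
  forall i j, (deadline I i <= deadline I j) = (deadline J i <= deadline J j).

Definition deadline_ordered (R : realType) (n : nat) (A : algorithm R n) : Prop :=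
  forall I J : instance R n,
    release I =1 release J -> proc I =1 proc J -> same_deadline_order I J ->
    A I = A J.

(* [F] is a class of instances, because a single instance taken in isolation is
   solved by an algorithm into which an optimal schedule is hard-wired: what
   forces the machines is that [A] has to meet all deadlines throughout [F]. *)
Definition requires_machines (R : realType) (n : nat) (F : set (instance R n))
    (A : algorithm R n) (q : nat) : Prop :=
  (forall I, F I -> feasible I (output A I)) ->
  forall I, F I -> (q <= machines A I)%N.

(* Main.v *)
(** Job [j] is released at [0] and has processing time [2 ^ j]. In the [k]-th
   instance job [k] is due at [2 ^ k], hence must run without interruption from
   time [0], and every other job [j] is due at [2 ^ j.+1 - 1]. One machine for
   job [k] and one running the other jobs in the order of their indices suffice,
   and the deadlines are always ordered like the indices. A deadline-ordered
   algorithm produces the same schedule on all these instances, so in this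
   schedule every job [k] occupies almost all of [0, 2 ^ k]; at almost every time
   in [0, 1] all [n] jobs are being processed simultaneously. *)
Require Import Defs.
From mathcomp Require Import all_boot all_order all_algebra.
From mathcomp Require Import all_classical all_reals all_analysis.
From mathcomp Require Import lra.

Local Open Scope classical_set_scope.

Import Order.TTheory GRing.Theory Num.Theory.
Local Open Scope ring_scope.

Section Schedules.
Context (R : realType) (k n : nat) (I : instance R n).

(** The slots are half-open, so that a job may start at the very moment its predecessor on the same
    machine ends. *)
Lemma nonpreemptive_feasible (mach : 'I_n -> 'I_k) (start : 'I_n -> R) :
  (forall j, release I j <= start j) ->
  (forall j, start j + proc I j <= deadline I j) ->
  (forall j j' t, mach j = mach j' -> start j <= t < start j + proc I j ->
     start j' <= t < start j' + proc I j' -> j = j') ->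
  exists s : schedule R k n, feasible I s.
Proof.
move=> rel_start start_dl disj.
pose runs i t j := (mach j == i) && (start j <= t < start j + proc I j).
pose s : schedule R k n := fun i t => [pick j | runs i t j].
have sP i t j : s i t = Some j <-> runs i t j.
  rewrite /s; case: pickP => [j' j'P|noj]; split=> [|jP] //.
  - by case=> <-.
  - congr Some; case/andP: j'P => /eqP mj' tj'; case/andP: jP => /eqP mj tj.
    by apply: (disj _ _ t) => //; rewrite mj' mj.
  - by rewrite noj in jP.
have busyE i j : busy s i j =
    if mach j == i then `[start j, start j + proc I j[%classic else set0.
  apply/seteqP; split=> t.
    by move=> /sP /andP[-> tj]; rewrite /= in_itv.
  case: ifPn => // mj; rewrite /= in_itv => tj.
  by apply/sP; rewrite /runs mj tj.
exists s; split.
- by move=> i j; rewrite busyE; case: ifP => _; [exact: measurable_itv|].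
- by move=> i i' t j /sP /andP[/eqP <- _] /sP /andP[/eqP <- _].
- move=> i j t /sP /andP[_ /andP[t1 t2]]; rewrite (le_trans (rel_start j) t1).
  by rewrite (le_trans (ltW t2)).
- move=> j; rewrite (bigD1 (mach j)) //= big1 => [|i /negPf ij].
    rewrite busyE eqxx adde0 lebesgue_measure_itv /= lte_fin ltrDl proc_gt0.
    by rewrite -EFinD addrAC subrr add0r.
  by rewrite busyE eq_sym ij measure0.
Qed.

(** The times at which [j] runs, disjoint across machines, form a subset of its window of measure
    [proc I j]. This is the length of the window, so the rest of it is null. *)
Lemma tight_busy (s : schedule R k n) (j : 'I_n) :
  feasible I s -> deadline I j = release I j + proc I j ->
  {ae lebesgue_measure, forall t : R,
     release I j <= t <= deadline I j -> exists i, s i t = Some j}.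
Proof.
move=> [mbusy one window total] tight.
pose U := \big[setU/set0]_(i < k) busy s i j.
have mU : measurable U by exact: bigsetU_measurable.
have UE t : U t <-> exists i, s i t = Some j.
  rewrite /U -bigcup_seq; split=> [[i _]|[i]] si; exists i => //.
  exact: mem_index_enum.
pose W := `[release I j, deadline I j]%classic : set R.
have muW : lebesgue_measure W = (proc I j)%:E.
  rewrite lebesgue_measure_itv /= lte_fin tight ltrDl proc_gt0.
  by rewrite -EFinD addrAC subrr add0r.
have UW : U `<=` W.
  by move=> t /UE[i /window]; rewrite /W /= in_itv.
have muU : lebesgue_measure U = (proc I j)%:E.
  have tU : trivIset setT (busy s ^~ j).
    by move=> i i' _ _ [t [si si']]; exact: one si si'.
  by rewrite -total; apply: measure_bigsetU_ord => // i; exact: mbusy.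
have mW : measurable W by exact: measurable_itv.
have null : lebesgue_measure (W `\` U) = 0%E.
  rewrite measureD //; last by rewrite /= muW ltry.
  by rewrite ((setIidPr W U).2 UW) /= muW muU subee.
exists (W `\` U); split; [exact: (measurableD mW mU)|exact: null|].
move=> t /= /not_implyP[tW noj]; split; first by rewrite /W /= in_itv.
by move/UE.
Qed.

End Schedules.

(** A finite union of null sets cannot cover [[a, b]], so some time in it is exceptional for no job.
    Choosing a machine for each job at that time is injective, since a machine runs one job at a
    time. *)
Lemma simultaneously_tight (R : realType) (k n : nat) (s : schedule R k n)
    (J : 'I_n -> instance R n) (a b : R) :
  a < b -> (forall j, feasible (J j) s) ->
  (forall j, deadline (J j) j = release (J j) j + proc (J j) j) ->
  (forall j, release (J j) j <= a) -> (forall j, b <= deadline (J j) j) ->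
  (n <= k)%N.
Proof.
move=> ab feas tight rel_a b_dl.
have busyW : {ae lebesgue_measure, forall t : R,
    forall j, release (J j) j <= t <= deadline (J j) j ->
    exists i, s i t = Some j}.
  by apply: filter_forall => j; exact: tight_busy.
have [t tab busy_t] : exists2 t, a <= t <= b & forall j, exists i, s i t = Some j.
  apply: contrapT => noex.
  have : lebesgue_measure.-negligible (`[a, b]%classic : set R).
    apply: negligibleS busyW => t /=; rewrite in_itv /= => tab busy_t.
    apply: noex; exists t => // j; apply: busy_t; case/andP: tab => at_ tb.
    by rewrite (le_trans (rel_a j) at_) (le_trans tb).
  move/negligibleP => /(_ (measurable_itv _)); rewrite /= lebesgue_measure_itv /=.
  by rewrite lte_fin ab -EFinD => -[] /eqP; rewrite subr_eq0 gt_eqF.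
have [f fP] := choice busy_t.
rewrite -(card_ord n) -(card_ord k); apply: (@leq_card _ _ f) => j j' ff.
by have := fP j; rewrite ff fP => -[].
Qed.

Section GeometricInstances.
Context (R : realType) (n : nat).

Definition geom_deadline (k j : 'I_n) : R :=
  if j == k then 2 ^+ j else 2 ^+ j.+1 - 1.

Definition geom_instance (k : 'I_n) : instance R n :=
  @Instance R n (fun=> 0) (fun j => 2 ^+ j) (geom_deadline k)
    (fun j => exprn_gt0 j (ltr0Sn _ _)).

(** Whichever case applies, the deadline of job [i] lies in [[2 ^ i, 2 ^ i.+1)], and these intervals
    are ordered like the indices, independently of [k]. *)
Lemma geom_deadline_mono (k i j : 'I_n) :
  (geom_deadline k i <= geom_deadline k j) = (i <= j)%N.
Proof.
have pow_ge1 (i' : nat) : 1 <= 2 ^+ i' :> R by rewrite exprn_ege1 ?ler1n.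
have lo (i' : 'I_n) : 2 ^+ i' <= geom_deadline k i'.
  by rewrite /geom_deadline exprS; case: ifP => // _; have := pow_ge1 i'; lra.
have lt_mono (i' j' : 'I_n) : (i' < j')%N ->
    geom_deadline k i' < geom_deadline k j'.
  move=> ij; have up : geom_deadline k i' < 2 ^+ i'.+1.
    by rewrite /geom_deadline exprS; case: ifP => _; have := pow_ge1 i'; lra.
  by rewrite (lt_le_trans up) // (le_trans _ (lo j')) // ler_weXn2l ?ler1n.
case: (ltngtP i j) => [ij|ji|/val_inj ->]; last by rewrite lexx.
- exact/ltW/lt_mono.
- by apply/negbTE; rewrite -ltNge lt_mono.
Qed.

Lemma geom_feasible (m : nat) (k : 'I_n) : (2 <= m)%N ->
  exists s : schedule R m n, feasible (geom_instance k) s.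
Proof.
move=> hm.
(* [2 ^ j - 1] is the total processing time of the jobs of smaller index; the slot of job [k] on the
   second machine stays idle. *)
apply: (@nonpreemptive_feasible _ _ _ _
  (fun j => if j == k then Ordinal (ltnW hm) else Ordinal hm)
  (fun j => if j == k then 0 else 2 ^+ j - 1)) => /=.
- by move=> j; case: ifP => // _; rewrite subr_ge0 exprn_ege1 ?ler1n.
- by move=> j; rewrite /geom_deadline exprS; case: ifP => _; lra.
move=> j j' t; case: eqP => [->|_]; case: eqP => [->|_] //= _.
have slot_end (i : 'I_n) : 2 ^+ i - 1 + 2 ^+ i = 2 ^+ i.+1 - 1 :> R.
  by rewrite exprS; lra.
rewrite !slot_end => /andP[jt tj] /andP[j't tj'].
(* Used in both directions, this shows that a time lies in only one slot of the second machine. *)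
have slot (i i' : 'I_n) : 2 ^+ i - 1 <= t -> t < 2 ^+ i'.+1 - 1 -> (i <= i')%N.
  move=> it ti'; rewrite -ltnS -(@ltr_eXn2l R 2) ?ltr1n //.
  by have := le_lt_trans it ti'; rewrite ltrD2r.
by apply/val_inj/eqP; rewrite eqn_leq !slot.
Qed.

End GeometricInstances.

Theorem theorem22 (R : realType) (m n : nat) (hm : (2 <= m)%N) (hn : (m < n)%N) :
  exists F : set (instance R n),
    [/\ F !=set0,
        forall I, F I -> exists s : schedule R m n, feasible I s
      & forall A : algorithm R n,
          deadline_ordered A -> requires_machines F A (n - 1)%N].
Proof.
exists (range (@geom_instance R n)); split.
- by exists (geom_instance R n (Ordinal hn)), (Ordinal hn).
- by move=> _ [k _ <-]; exact: geom_feasible.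
move=> A ordA feasA _ [k0 _ <-].
have sameA k : A (geom_instance R n k) = A (geom_instance R n k0).
  by apply: ordA => // i j; rewrite /= !geom_deadline_mono.
(* The argument gives [n] machines, one more than claimed. *)
apply: (leq_trans (leq_subr 1 n)).
apply: (@simultaneously_tight R _ n (output A (geom_instance R n k0))
  (geom_instance R n) 0 1) => //= [k|k|k].
- have := feasA _ (imageT (geom_instance R n) k).
  by rewrite /output /machines sameA.
- by rewrite /geom_deadline eqxx add0r.
- by rewrite /geom_deadline eqxx exprn_ege1 ?ler1n.
Qed.
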